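(* The largest number of mutually unbiased unit weighing matrices of order $5$ and weight $4$ is $5$; that is, there exists a set of $5$ mutually unbiased unit weighing matrices of order $5$ and weight $4$, and every set of mutually unbiased unit weighing matrices of order $5$ and weight $4$ has at most $5$ elements.
   Context: A (unit) weighing matrix of order $n$ and weight $w$, denoted $UW(n,w)$, is an $n\times n$ complex matrix $W$ all of whose entries have absolute value $0$ or $1$ and which satisfies $WW^*=wI_n$, where $W^*$ is the conjugate transpose. Two unit weighing matrices $H,K$ of order $n$ and weight $w$ are unbiased if $HK^*=\sqrt{w}\,L$ for some unit weighing matrix $L$ of order $n$ and weight $w$. A set of unit weighing matrices of the same order and weight is mutually unbiased if any two distinct members are unbiased. *)

(* Defs.v *)
From mathcomp Require Import all_boot all_order all_algebra.
From mathcomp Require Import complex classical_sets cardinality reals.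

Set Implicit Arguments.
Unset Strict Implicit.
Unset Printing Implicit Defensive.

Import Order.TTheory GRing.Theory Num.Theory.

Local Open Scope ring_scope.
Local Open Scope classical_set_scope.
Local Open Scope sesquilinear_scope.

Section UnitWeighing.
Variable R : realType.

(* The norm of [R[i]] takes its values in the real elements of [R[i]] itself. *)
Definition unit_weighing (n w : nat) (W : 'M[R[i]]_n) : Prop :=
  (forall i j, `|W i j| = 0 \/ `|W i j| = 1) /\ W *m W ^t* = (w%:R)%:M.

Definition unbiased (n w : nat) (H K : 'M[R[i]]_n) : Prop :=
  exists L : 'M[R[i]]_n,
    unit_weighing w L /\ H *m K ^t* = sqrtC (w%:R) *: L.

Definition mutually_unbiased (n w : nat) (S : set 'M[R[i]]_n) : Prop :=
  (forall W, S W -> unit_weighing w W) /\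
  (forall H K, S H -> S K -> H <> K -> unbiased w H K).

End UnitWeighing.

(* Main.v *)
Require Import Defs.
From mathcomp Require Import all_boot all_order all_algebra.
From mathcomp Require Import complex boolp classical_sets cardinality reals.
(* fintype and finset come last: finite sets prevail where names clash. *)
From mathcomp Require Import ring perm fintype finset.

Set Implicit Arguments.
Unset Strict Implicit.
Unset Printing Implicit Defensive.

Import Order.TTheory GRing.Theory Num.Theory.

Local Open Scope ring_scope.
Local Open Scope sesquilinear_scope.

(** The rows of a unit weighing matrix of order 5 and weight 4 have one zero
    each, and so have the columns. Index the rows by the position of their
    zero: the diagonal becomes zero. Two rows then overlap in three places, and
    three numbers of modulus one sum to zero only when they are proportional to
    the three cube roots of unity. This makes unbiased pairs completely rigid.

    Let H, K be unbiased with zero diagonals, and write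
    K p j = r p j * H p j. The inner products of row p of K with the rows of H
    have modulus 0 or 2, and one of them is 0. If the zero occurs against
    another row of H, three of the four ratios r p j agree and the last is
    their negative; if it occurs against row p of H, the four ratios form two
    antipodal pairs, and the remaining inner products force the two pairs to
    have equal squares ([ratio_sq_const]). So the ratios in a row agree up to
    sign. Orthogonality of the rows of K then forces the sign of
    r p j / r p l to be independent of p ([ratio_cross]), and K is obtained from
    H by negating a set A of columns and rescaling rows
    ([signed_copy_exists]). As row p of K has inner product of modulus 0 or 2,
    not 4, with row p of H, the signs are not constant off any p, which means
    that A can be taken of size 2 ([signed_copy_card]).

    Applied to all members of a mutually unbiased set but a fixed one, this
    gives pairs of columns; two members with equal or disjoint pairs would have
    an inner product of modulus 4 ([signed_copies_meet]). Intersecting families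
    of pairs of five points lie in a star or a triangle, so have at most 4
    elements ([intersecting_pairs]), which bounds the whole set by 5.

    The star is realized by negating one column at a time, in all five ways, of
    a single matrix with entries among 0 and the cube roots of unity: any two
    of the results differ by the negation of two columns
    ([flips_mutually_unbiased]). *)

(** * Sums of numbers of modulus one *)

Section UnitNumbers.
Variable C : numClosedFieldType.
Implicit Types a b c d u w x y z : C.

Lemma unit_mul_conj a : `|a| = 1 -> a * a^* = 1.
Proof. by move=> a1; rewrite -normCK a1 expr1n. Qed.

Lemma unit_neq0 a : `|a| = 1 -> a != 0.
Proof. by move=> a1; rewrite -normr_eq0 a1 oner_neq0. Qed.

(** With w = b / a, the modulus of 1 + w equals that of c, hence
    w + w^* + 1 = 0, and w^* is the inverse of w. *)
Lemma unit_triple_cube_root a b c :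
    `|a| = 1 -> `|b| = 1 -> `|c| = 1 -> a + b + c = 0 ->
  exists w, [/\ w ^+ 2 + w + 1 = 0, b = w * a & c = w ^+ 2 * a].
Proof.
move=> a1 b1 c1 abc0; have a0 := unit_neq0 a1.
exists (b / a).
have w1 : `|b / a| = 1 by rewrite normf_div a1 b1 divr1.
have bE : b = b / a * a by rewrite divfK.
have cE : c = - (1 + b / a) * a.
  by rewrite mulNr mulrDl mul1r -bE; apply/eqP; rewrite -addr_eq0 addrC abc0.
have v1 : `|1 + b / a| = 1.
  by move: c1; rewrite {1}cE normrM normrN a1 mulr1.
suff wq : (b / a) ^+ 2 + b / a + 1 = 0.
  by split=> //; rewrite {1}cE; congr (_ * _); rewrite -[LHS](addr0) -wq; ring.
move: (unit_mul_conj w1) (unit_mul_conj v1); rewrite rmorphD rmorph1 /=.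
move: (b / a) => w; move: (w^*) => w' ww' vv'.
have -> : w ^+ 2 + w + 1 =
  w * ((1 + w) * (1 + w') - 1) - (1 + w) * (w * w' - 1) by ring.
by rewrite ww' vv'; ring.
Qed.

Lemma cube_root_unity w : w ^+ 2 + w + 1 = 0 -> w ^+ 3 = 1.
Proof.
move=> wq; have -> : w ^+ 3 = (w - 1) * (w ^+ 2 + w + 1) + 1 by ring.
by rewrite wq mulr0 add0r.
Qed.

Lemma cube_root_norm w : w ^+ 2 + w + 1 = 0 -> `|w| = 1.
Proof.
move/cube_root_unity => w3; apply/eqP.
by rewrite -(@pexpr_eq1 _ _ 3) // -normrX w3 normr1.
Qed.

Lemma cube_root_conj w : w ^+ 2 + w + 1 = 0 -> w^* = w ^+ 2.
Proof.
move=> wq; have w0 := unit_neq0 (cube_root_norm wq).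
apply: (mulfI w0); rewrite unit_mul_conj ?cube_root_norm // -exprS.
by rewrite cube_root_unity.
Qed.

Lemma cube_root_pair w x :
  w ^+ 2 + w + 1 = 0 -> x ^+ 2 + x + 1 = 0 -> x = w \/ x = w ^+ 2.
Proof.
move=> wq xq; have /eqP : (x - w) * (x + (w + 1)) = 0.
  have -> : (x - w) * (x + (w + 1)) = (x ^+ 2 + x + 1) - (w ^+ 2 + w + 1).
    by ring.
  by rewrite wq xq subrr.
rewrite mulf_eq0 subr_eq0 => /orP[/eqP ->|]; first by left.
move=> /eqP xE; right; apply/(addIr (w + 1)).
by rewrite xE addrA wq.
Qed.

(** Up to a factor, both triples (a, b, c) and (x a, y b, z c) run through the
    cube roots of unity. In the same cyclic order, x = y = z; in opposite
    orders, x, y, z run through the cube roots as well, up to a factor. *)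
Lemma twisted_unit_triple x y z a b c :
    `|x| = 1 -> `|y| = 1 -> `|z| = 1 -> `|a| = 1 -> `|b| = 1 -> `|c| = 1 ->
    a + b + c = 0 -> x * a + y * b + z * c = 0 ->
  (x = y /\ x = z) \/ x + y + z = 0.
Proof.
move=> x1 y1 z1 a1 b1 c1 abc xabc; have a0 := unit_neq0 a1.
have n1 (s t : C) : `|s| = 1 -> `|t| = 1 -> `|s * t| = 1.
  by move=> s1 t1; rewrite normrM s1 t1 mulr1.
have [w [wq bE cE]] := unit_triple_cube_root a1 b1 c1 abc.
have [v [vq yE zE]] :=
  unit_triple_cube_root (n1 _ _ x1 a1) (n1 _ _ y1 b1) (n1 _ _ z1 c1) xabc.
have w0 := unit_neq0 (cube_root_norm wq); have w3 := cube_root_unity wq.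
have yw : y * w = v * x by apply: (mulIf a0); rewrite -[LHS]mulrA -bE yE mulrA.
have zw : z * w ^+ 2 = v ^+ 2 * x.
  by apply: (mulIf a0); rewrite -[LHS]mulrA -cE zE mulrA.
have [vE|vE] := cube_root_pair wq vq; rewrite {}vE in yw zw.
- left; split; first by apply: (mulIf w0); rewrite yw mulrC.
  by apply: (mulIf (expf_neq0 2 w0)); rewrite zw mulrC.
- right; have -> : y = w * x by apply: (mulIf w0); rewrite yw; ring.
  have -> : z = w ^+ 2 * x by apply: (mulIf (expf_neq0 2 w0)); rewrite zw; ring.
  have -> : x + w * x + w ^+ 2 * x = (w ^+ 2 + w + 1) * x by ring.
  by rewrite wq mul0r.
Qed.

(** Conjugation inverts numbers of modulus one, so the first and the third
    elementary symmetric functions of a, b, c, d vanish together; then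
    (a + b) (a + c) (a + d) vanishes too. *)
Lemma unit_quadruple a b c d :
    `|a| = 1 -> `|b| = 1 -> `|c| = 1 -> `|d| = 1 -> a + b + c + d = 0 ->
  [\/ a = - b, a = - c | a = - d].
Proof.
move=> a1 b1 c1 d1 abcd.
have conj_sum : a^* + b^* + c^* + d^* = 0 by rewrite -!rmorphD abcd rmorph0.
have : (a + b) * (a + c) * (a + d) = 0.
  have dE : d = - (a + b + c) by apply/eqP; rewrite -addr_eq0 addrC abcd.
  have -> : (a + b) * (a + c) * (a + d) = (a + b + c + d) * a ^+ 2 +
     (a * b * c * d) * (a^* + b^* + c^* + d^*) - b * c * d * (a * a^* - 1)
     - a * c * d * (b * b^* - 1) - a * b * d * (c * c^* - 1)
     - a * b * c * (d * d^* - 1) by ring.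
  by rewrite abcd conj_sum !unit_mul_conj // subrr !mulr0 mul0r !subr0 addr0.
move/eqP; rewrite !mulf_eq0 !addr_eq0 => /orP[/orP[]|] /eqP ->;
  by [constructor 1|constructor 2|constructor 3].
Qed.

(** The possible moduli of the inner products between rows of two unbiased
    matrices of weight 4, whose scalar factor is the square root of 4. *)
Definition zero_or_two z := `|z| = 0 \/ `|z| = 2%:R.

Lemma zero_or_two_unit z : zero_or_two z -> `|z| <> 1.
Proof.
by move=> [] -> /eqP; [rewrite (eqr_nat _ 0 1)|rewrite (eqr_nat _ 2 1)].
Qed.

Lemma zero_or_two_four z : zero_or_two z -> `|z| <> 4%:R.
Proof.
by move=> [] -> /eqP; [rewrite (eqr_nat _ 0 4)|rewrite (eqr_nat _ 2 4)].
Qed.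

(** The modulus is at least 2, so it is 2, which is the case of equality in the
    triangle inequality. *)
Lemma unit_sum_minus x z :
  `|x| = 1 -> `|z| = 1 -> zero_or_two (z + x + x + x) -> z = - x.
Proof.
move=> x1 z1 [|]; have x0 := unit_neq0 x1.
  move/normr0P/eqP; have -> : z + x + x + x = z + 3%:R * x by ring.
  move/eqP; rewrite addr_eq0 => /eqP zE.
  move: z1; rewrite zE normrN normrM x1 normr_nat mulr1.
  by move/eqP; rewrite (eqr_nat _ 3 1).
move=> n2; have := unit_mul_conj x1; have := unit_mul_conj z1.
have: (z + x + x + x) * (z + x + x + x)^* = 4%:R.
  by rewrite -normCK n2 -natrX.
rewrite !rmorphD /= ; set x' := x^*; set z' := z^* => e zz xx.
have : (z + x) ^+ 2 = 0.
  have -> : (z + x) ^+ 2 =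
   3%:R^-1 * (x * z * ((z + x + x + x) * (z' + x' + x' + x') - 4%:R)
     - x * z * (z * z' - 1) - 9%:R * x * z * (x * x' - 1)
     - 3%:R * z ^+ 2 * (x * x' - 1) - 3%:R * x ^+ 2 * (z * z' - 1)).
     by field.
  by rewrite e zz xx !subrr !mulr0 !subr0 mulr0.
by move/eqP; rewrite expf_eq0 /= addr_eq0 => /eqP.
Qed.

(** Up to the factor a the sum is x + y (w - w^2), where w is a primitive cube
    root of unity. Since w - w^2 is a purely imaginary number of modulus the
    square root of 3, the sum does not vanish, and its modulus is 2 only if x
    is orthogonal to 'i y in the plane, that is, x = y or x = - y. *)
Lemma antipodal_pair x y a b c :
    `|x| = 1 -> `|y| = 1 -> `|a| = 1 -> `|b| = 1 -> `|c| = 1 ->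
    a + b + c = 0 -> zero_or_two (x * a + y * b + (- y) * c) ->
  x ^+ 2 = y ^+ 2.
Proof.
move=> x1 y1 a1 b1 c1 abc; have a0 := unit_neq0 a1.
have [w [wq -> ->]] := unit_triple_cube_root a1 b1 c1 abc.
have w0 := unit_neq0 (cube_root_norm wq).
have -> : x * a + y * (w * a) + (- y) * (w ^+ 2 * a) =
    (x + y * (w - w ^+ 2)) * a.
  by ring.
have sqE : (w - w ^+ 2) ^+ 2 = - 3%:R.
  have -> : (w - w ^+ 2) ^+ 2 =
    (w ^+ 2 + w + 1) * (w ^+ 2 - 3%:R * w + 3%:R) - 3%:R by ring.
  by rewrite wq mul0r add0r.
rewrite /zero_or_two normrM a1 mulr1 => -[/normr0P/eqP/eqP|n2].
  rewrite addr_eq0 => /eqP /(congr1 (fun t => `|t ^+ 2|)).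
  rewrite sqrrN exprMn sqE normrX x1 normrM normrN normrX y1 expr1n mul1r.
  by rewrite normr_nat => /eqP; rewrite (eqr_nat _ 1 3).
have := unit_mul_conj x1; have := unit_mul_conj y1.
have : (x + y * (w - w ^+ 2)) * (x + y * (w - w ^+ 2))^* = 4%:R.
  by rewrite -normCK n2 -natrX.
rewrite rmorphD rmorphM rmorphB rmorphXn /= (cube_root_conj wq).
have -> : (w ^+ 2) ^+ 2 = w.
  by rewrite -exprM (exprS _ 3) cube_root_unity // mulr1.
set x' := x^*; set y' := y^* => e yy xx.
have /eqP : (w - w ^+ 2) * (y ^+ 2 - x ^+ 2) = 0.
  have -> : (w - w ^+ 2) * (y ^+ 2 - x ^+ 2) =
   x * y * ((x + y * (w - w ^+ 2)) * (x' + y' * (w ^+ 2 - w)) - 4%:R)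
   - x * y * (x * x' - 1) + x * y * ((w - w ^+ 2) ^+ 2 * (y * y') + 3%:R)
   - (w - w ^+ 2) * y ^+ 2 * (x * x' - 1)
   + (w - w ^+ 2) * x ^+ 2 * (y * y' - 1) by ring.
  by rewrite e xx yy sqE; ring.
rewrite mulf_eq0 [X in _ || X]subr_eq0 => /orP[/eqP t0|/eqP ->//].
move: sqE; rewrite t0 expr0n => /eqP.
by rewrite eq_sym oppr_eq0 (eqr_nat _ 3 0).
Qed.
End UnitNumbers.

(** * Enumerations of five indices *)

Section FivePoints.
Implicit Types (p q a b c d j : 'I_5) (s : seq 'I_5).

Lemma uniq_extend s : uniq s -> exists t, uniq (s ++ t) /\ size (s ++ t) = 5.
Proof.
move=> Us; pose t := [seq x <- enum 'I_5 | x \notin s].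
have Ust : uniq (s ++ t).
  rewrite cat_uniq Us filter_uniq ?enum_uniq // andbT.
  by apply/hasPn => x; rewrite mem_filter => /andP[].
exists t; split=> //.
rewrite -[RHS]card_ord -(card_uniqP Ust); apply: eq_card => x.
by rewrite mem_cat mem_filter mem_enum andbT orbN.
Qed.

Lemma uniq_extend1 p q a b :
  uniq [:: p; q; a; b] -> exists c, uniq [:: p; q; a; b; c].
Proof. by move=> /uniq_extend[[|c [|? ?]] [] //= U _]; exists c. Qed.

Lemma uniq5_all p a b c d j :
  uniq [:: p; a; b; c; d] -> j \in [:: p; a; b; c; d].
Proof.
have mem_all i : i \in enum 'I_5 by rewrite mem_enum.
move=> U; have [] := @uniq_min_size _ [:: p; a; b; c; d] (enum 'I_5) U.
- by move=> i.
- by rewrite size_enum_ord.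
by move=> _ ->.
Qed.

(** Names the five indices, so that an inner product of two rows becomes an
    explicit sum without a choice of numerical positions. *)
Lemma sum5 (V : nmodType) (F : 'I_5 -> V) p a b c d :
  uniq [:: p; a; b; c; d] ->
  \sum_j F j = F p + F a + F b + F c + F d.
Proof.
move=> U; rewrite (perm_big [:: p; a; b; c; d]); last first.
  apply: (uniq_perm (index_enum_uniq _) U) => j.
  by rewrite uniq5_all ?mem_index_enum.
by rewrite !big_cons big_nil /= addr0 !addrA.
Qed.

Lemma exists_notin s : (size s < 5)%N -> exists p, p \notin s.
Proof.
move=> s5; apply/existsP; apply: contraLR s5.
rewrite negb_exists -leqNgt => /forallP all_s.
rewrite -[X in (X <= _)%N](card_ord 5) (leq_trans _ (card_size s)) //.
by apply/subset_leq_card/subsetP => p _; have := all_s p; rewrite negbK.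
Qed.

End FivePoints.

(** * Rigidity of unbiased pairs *)

Section HollowFrames.
Variable C : numClosedFieldType.
Implicit Types (H K M : 'M[C]_5) (p q j l : 'I_5) (A B : {set 'I_5}).

(** A unit weighing matrix of order 5 and weight 4 whose rows are indexed by
    their zeros. *)
Definition hollow_frame H :=
  (forall p j, `|H p j| = (p != j)%:R) /\
  (forall p q, p != q -> (H *m H ^t*) p q = 0).

(** What unbiasedness says on inner products: the rows of the third weighing
    matrix, having weight 4, contribute a zero each. *)
Definition unbiased_frames K H :=
  (forall p q, zero_or_two ((K *m H ^t*) p q)) /\
  (forall p, exists q, (K *m H ^t*) p q = 0).

(** K is H with the columns in A negated, up to phases of the rows. *)
Definition signed_copy H A K :=
  exists2 c : 'I_5 -> C, forall p, `|c p| = 1 &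
    forall p j, K p j = c p * (-1) ^+ (j \in A) * H p j.

Lemma mulmx_adjE K M p q : (K *m M ^t*) p q = \sum_j K p j * (M q j)^*.
Proof. by rewrite mxE; apply: eq_bigr => j _; rewrite !mxE. Qed.

Lemma hollow_diag H p : hollow_frame H -> H p p = 0.
Proof. by case=> nH _; apply/eqP; rewrite -normr_eq0 nH eqxx. Qed.

Lemma hollow_unit H p j : hollow_frame H -> j != p -> `|H p j| = 1.
Proof. by case=> nH _ jp; rewrite nH eq_sym jp. Qed.

Lemma hollow_inner3 K M p q a b c :
    hollow_frame K -> hollow_frame M -> uniq [:: p; q; a; b; c] ->
  (K *m M ^t*) p q =
    K p a * (M q a)^* + K p b * (M q b)^* + K p c * (M q c)^*.
Proof.
move=> hK hM U; rewrite mulmx_adjE (sum5 _ U) !hollow_diag //.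
by rewrite rmorph0 mulr0 mul0r !add0r.
Qed.

Section Ratios.
Variables H K : 'M[C]_5.
Hypotheses (hH : hollow_frame H) (hK : hollow_frame K).
Hypothesis KH : unbiased_frames K H.

(** r compares K with H entry by entry. Two distinct rows of H overlap in three
    places, where the terms u of their inner product sum to zero. *)
Let r p j := K p j * (H p j)^*.
Let u p q j := H p j * (H q j)^*.

Let r_unit p j : j != p -> `|r p j| = 1.
Proof. by move=> jp; rewrite normrM norm_conjC !hollow_unit // mulr1. Qed.

Let u_unit p q j : j != p -> j != q -> `|u p q j| = 1.
Proof. by move=> jp jq; rewrite normrM norm_conjC !hollow_unit // mulr1. Qed.

Let ratioE p j : K p j = r p j * H p j.
Proof.
have [->|jp] := eqVneq j p; first by rewrite !hollow_diag ?mulr0.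
by rewrite -mulrA [_^* * _]mulrC unit_mul_conj ?mulr1 ?hollow_unit.
Qed.

Let u_sum p q a b c : uniq [:: p; q; a; b; c] ->
  u p q a + u p q b + u p q c = 0.
Proof.
move=> U; rewrite -(hollow_inner3 hH hH U) (proj2 hH) //.
by move: U => /= /andP[]; rewrite !inE !negb_or => /andP[].
Qed.

Let inner_KH p q a b c : uniq [:: p; q; a; b; c] ->
  (K *m H ^t*) p q = r p a * u p q a + r p b * u p q b + r p c * u p q c.
Proof. by move=> U; rewrite (hollow_inner3 hK hH U) !ratioE -!mulrA. Qed.

Let inner_KH_diag p a b c d : uniq [:: p; a; b; c; d] ->
  (K *m H ^t*) p p = r p a + r p b + r p c + r p d.
Proof.
by move=> U; rewrite mulmx_adjE (sum5 _ U) hollow_diag // mul0r add0r.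
Qed.

Let inner_KK p q a b c : uniq [:: p; q; a; b; c] ->
  (K *m K ^t*) p q =
    r p a * (r q a)^* * u p q a + r p b * (r q b)^* * u p q b
    + r p c * (r q c)^* * u p q c.
Proof.
by move=> U; rewrite (hollow_inner3 hK hK U) !ratioE !rmorphM /u; ring.
Qed.

Let uniq_neqs p q a b c : uniq [:: p; q; a; b; c] ->
  [/\ a != p, b != p & c != p] /\ [/\ a != q, b != q, c != q & q != p].
Proof.
rewrite /= !inE !negb_or -!andbA => U.
by split; split; rewrite // eq_sym; move: U; do ![case/andP=> ?].
Qed.

(** The zero falls on the row of H with the same zero position. Here b, c, d are
    the common places of row p of K and row a of H; their ratios are - r p a and
    an antipodal pair, to which [antipodal_pair] applies. *)
Let sq_const_antipodal p a b c d : uniq [:: p; a; b; c; d] ->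
    r p a = - r p b -> r p a + r p b + r p c + r p d = 0 ->
  exists x, forall j, j != p -> r p j ^+ 2 = x.
Proof.
move=> U ab; rewrite ab addNr add0r => /eqP; rewrite addrC addr_eq0 => /eqP dc.
have [[bp cp dp] [ba ca da ap]] := uniq_neqs U.
have bc : r p b ^+ 2 = r p c ^+ 2.
  apply: (antipodal_pair (a := u p a b) (b := u p a c) (c := u p a d));
    rewrite ?r_unit ?u_unit ?u_sum //.
  by rewrite -dc -inner_KH //; case: KH.
exists (r p c ^+ 2) => j jp; have := uniq5_all j U.
rewrite !inE (negPf jp) /= => /or4P[] /eqP -> //.
  by rewrite ab sqrrN.
by rewrite dc sqrrN.
Qed.

Let swap23 p a b c d : uniq [:: p; a; b; c; d] -> uniq [:: p; a; c; b; d].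
Proof.
by rewrite (perm_uniq (_ : perm_eq _ [:: p; a; c; b; d])) //;
  apply/seq.permP => P /=; ring.
Qed.

Let swap24 p a b c d : uniq [:: p; a; b; c; d] -> uniq [:: p; a; d; c; b].
Proof.
by rewrite (perm_uniq (_ : perm_eq _ [:: p; a; d; c; b])) //;
  apply/seq.permP => P /=; ring.
Qed.

(** If the vanishing inner product is against another row q of H, the ratios at
    the three common places agree: otherwise these ratios sum to zero and the
    inner product with row p of H is r p q, of modulus one. *)
Lemma ratio_sq_const p : exists x, forall j, j != p -> r p j ^+ 2 = x.
Proof.
have [K2 K0] := KH; have [q pq0] := K0 p.
have [qp|qp] := eqVneq q p.
  rewrite {}qp in pq0.
  have [t [U]] := @uniq_extend [:: p] isT.
  case: t U => [|a [|b [|c [|d [|? ?]]]]] //= U _.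
  have [[bp cp dp] [ba ca da ap]] := uniq_neqs U.
  rewrite (inner_KH_diag U) in pq0.
  have [||||ab|ac|ad] := unit_quadruple _ _ _ _ pq0; rewrite ?r_unit //.
  - exact: sq_const_antipodal U ab pq0.
  - apply: (sq_const_antipodal (swap23 U) ac).
    by rewrite -[RHS]pq0; ring.
  - apply: (sq_const_antipodal (swap24 U) ad).
    by rewrite -[RHS]pq0; ring.
have : uniq [:: p; q] by rewrite /= inE eq_sym qp.
move=> /uniq_extend[t [U]]; case: t U => [|a [|b [|c [|? ?]]]] //= U _.
have [[ap bp cp] [aq bq cq _]] := uniq_neqs U.
have := K2 p p; rewrite (inner_KH_diag U).
rewrite (inner_KH U) in pq0.
have [|||||||[ab ac]|s0] := twisted_unit_triple _ _ _ _ _ _ _ pq0;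
  rewrite ?r_unit ?u_unit ?u_sum //.
- rewrite -ab -ac => /unit_sum_minus rq.
  exists (r p a ^+ 2) => j jp; have := uniq5_all j U.
  rewrite !inE (negPf jp) /= => /or4P[] /eqP -> //; rewrite -?ab -?ac //.
  by rewrite rq ?r_unit ?sqrrN.
- rewrite -!addrA [X in _ + X]addrA s0 addr0 => /zero_or_two_unit.
  by rewrite r_unit.
Qed.

(** The ratios y between rows p and q turn the vanishing sum of the u into the
    vanishing inner product of rows p and q of K. As the y have equal squares,
    they do not sum to zero, so [twisted_unit_triple] makes them equal. *)
Lemma ratio_cross p q j l : p != q -> j != p -> j != q -> l != p -> l != q ->
  r p j * r q l = r p l * r q j.
Proof.
move=> pq jp jq lp lq; have [->//|jl] := eqVneq j l.
have [m U] : exists m, uniq [:: p; q; j; l; m].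
  apply: uniq_extend1; rewrite /= !inE !negb_or pq jl (eq_sym p j) (eq_sym p l).
  by rewrite (eq_sym q j) (eq_sym q l) jp jq lp lq.
have [[_ _ mp] [_ _ mq _]] := uniq_neqs U.
pose y x := r p x * (r q x)^*.
have y1 x : x != p -> x != q -> `|y x| = 1.
  by move=> xp xq; rewrite normrM norm_conjC !r_unit // mulr1.
have [e yy] : exists e, forall x, x != p -> x != q -> y x ^+ 2 = e.
  have [ep rp] := ratio_sq_const p; have [eq rq] := ratio_sq_const q.
  by exists (ep * eq^*) => x xp xq; rewrite exprMn -rmorphXn /= rp ?rq.
have /eqP : (K *m K ^t*) p q = 0 by apply: (proj2 hK).
rewrite (inner_KK U) => /eqP yu0.
suff yE : y j = y l.
  have rqj := unit_mul_conj (r_unit jq); have rql := unit_mul_conj (r_unit lq).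
  transitivity (y j * (r q j * r q l)).
    by rewrite -[LHS]mulr1 -rqj /y; ring.
  by rewrite yE -[RHS]mulr1 -rql /y; ring.
have [||||||[]//|s0] := twisted_unit_triple _ _ _ _ _ _ (u_sum U) yu0;
  rewrite ?y1 ?u_unit //.
have /eqP : y j ^+ 2 = y l ^+ 2 by rewrite !yy.
rewrite eqf_sqr => /orP[/eqP //|/eqP jE].
move: s0; rewrite -/(y j) -/(y l) -/(y m) jE addNr add0r => m0.
by have := y1 m mp mq; rewrite m0 normr0 => /eqP; rewrite (eqr_nat _ 0 1).
Qed.

(** Signs relative to a base column o do not depend on the row, by
    [ratio_cross], provided the row is not o itself. Row o is compared with the
    others through a second base column l. *)
Lemma signed_copy_exists : exists A, signed_copy H A K.
Proof.
have [o [l lo]] : exists o l : 'I_5, l != o by exists ord0, ord_max.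
(* The columns whose sign is opposite to that of column o in some row other than
   o and hence, by ratio_cross, in all such rows. *)
pose A := [set j | [exists p, [&& p != o, p != j, j != o & r p j == - r p o]]].
have oA : o \notin A.
  by rewrite inE negb_exists; apply/forallP => p; rewrite eqxx /= !andbF.
have rA p j : p != o -> j != p -> r p j = (-1) ^+ (j \in A) * r p o.
  move=> po jp; have [->|jo] := eqVneq j o.
    by rewrite (negPf oA) mul1r.
  have op : o != p by rewrite eq_sym.
  have [|] := boolP (j \in A); rewrite inE.
    case/existsP => q /and4P[qo qj _ /eqP rq]; rewrite mulN1r.
    have [->//|pq] := eqVneq p q.
    have oq : o != q by rewrite eq_sym.
    apply: (mulIf (unit_neq0 (r_unit oq))).
    by rewrite (ratio_cross pq) // ?(eq_sym j q) // rq mulrN mulNr.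
  rewrite negb_exists => /forallP /(_ p); rewrite po jo eq_sym jp /= => rN.
  have [x rx] := ratio_sq_const p.
  have /eqP : r p j ^+ 2 = r p o ^+ 2 by rewrite !rx.
  by rewrite eqf_sqr (negPf rN) orbF mul1r => /eqP.
clearbody A; exists A.
exists (fun p => if p == o then r o l * (-1) ^+ (l \in A) else r p o).
  move=> p; have [_|po] := eqVneq p o.
    by rewrite normrM normr_sign mulr1 r_unit.
  by rewrite r_unit // eq_sym.
move=> p j; have [->|jp] := eqVneq j p; first by rewrite !hollow_diag ?mulr0.
rewrite ratioE /=; have [po|po] := eqVneq p o; last first.
  by rewrite rA // [_ * r p o]mulrC.
rewrite po in jp *; congr (_ * _).
have [q] := @exists_notin [:: o; l; j] isT; rewrite !inE !negb_or.
case/and3P => qo ql qj.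
have oq : o != q by rewrite eq_sym.
apply: (mulIf (unit_neq0 (r_unit (_ : l != q)))); first by rewrite eq_sym.
have lq : l != q by rewrite eq_sym.
have jq : j != q by rewrite eq_sym.
apply: etrans (ratio_cross oq jp jq lo lq) _.
rewrite (rA q j qo jq) (rA q l qo lq).
by case: (l \in A) => /=; ring.
Qed.

End Ratios.

Lemma signed_copy_self H : signed_copy H set0 H.
Proof.
by exists (fun=> 1) => [p|p j]; rewrite ?normr1 // inE !mul1r.
Qed.

Lemma signed_copy_compl H A K : signed_copy H A K -> signed_copy H (~: A) K.
Proof.
case=> c c1 KE; exists (fun p => - c p) => [p|p j]; first by rewrite normrN.
by rewrite KE inE; case: (j \in A); rewrite /= ?mulrN ?mulNr ?opprK ?mulr1.
Qed.

(** Otherwise the rows p of the two copies are proportional, and their inner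
    product has modulus 4. *)
Lemma signed_copies_differ H A B K M p b :
    hollow_frame H -> signed_copy H A K -> signed_copy H B M ->
    zero_or_two ((K *m M ^t*) p p) ->
  ~ forall j, j != p -> (j \in A) (+) (j \in B) = b.
Proof.
move=> hH [c c1 KE] [d d1 ME] /zero_or_two_four ip4 AB; apply: ip4.
have -> : (K *m M ^t*) p p = c p * (d p)^* * (-1) ^+ b * 4%:R.
  rewrite mulmx_adjE (bigD1 p) //= KE hollow_diag // !mulr0 mul0r add0r.
  rewrite (eq_bigr (fun=> c p * (d p)^* * (-1) ^+ b)) => [|j jp].
    by rewrite sumr_const cardC1 card_ord mulr_natr.
  rewrite KE ME !rmorphM rmorph_sign -(AB j jp) signr_addb /=.
  rewrite -[RHS]mulr1 -(unit_mul_conj (hollow_unit hH jp)); ring.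
by rewrite !normrM norm_conjC c1 d1 normr_sign normr_nat !mul1r.
Qed.

(** A set with at most one element is constant off a point, and so is the
    complement of such a set; only sizes 2 and 3 are left, exchanged by
    complementation. *)
Lemma signed_copy_card H A K :
    hollow_frame H -> signed_copy H A K ->
    (forall p, zero_or_two ((K *m H ^t*) p p)) ->
  exists2 B : {set 'I_5}, #|B| = 2%N & signed_copy H B K.
Proof.
move=> hH KA KH.
have big (B : {set 'I_5}) : signed_copy H B K -> (1 < #|B|)%N.
  move=> KB; rewrite ltnNge; apply/negP => B1.
  have [p Bp] : exists p, forall j, j != p -> j \notin B.
    have [B0|[p pB]] := set_0Vmem B.
      by exists ord0 => j _; rewrite B0 inE.
    exists p => j; apply: contraNN => jB.
    by apply/eqP; apply: (card_le1_eqP B1).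
  apply: (signed_copies_differ (b := false) hH KB (signed_copy_self H) (KH p)).
  by move=> j jp; rewrite in_set0 addbF; apply: negPf (Bp j jp).
have [A2|A3] := leqP #|A| 2%N.
  by exists A => //; apply/eqP; rewrite eqn_leq A2 big.
exists (~: A); last exact: signed_copy_compl.
apply/eqP; rewrite eqn_leq big ?andbT; last exact: signed_copy_compl.
by rewrite -(leq_add2l #|A|) cardsC card_ord (leq_add2r 2%N 3%N).
Qed.

(** Two disjoint pairs leave one point p uncovered, and off p exactly one of the
    two signs is negative. *)
Lemma signed_copies_meet H A B K M :
    hollow_frame H -> signed_copy H A K -> signed_copy H B M ->
    #|A| = 2%N -> #|B| = 2%N -> (forall p, zero_or_two ((K *m M ^t*) p p)) ->
  A != B /\ A :&: B != set0.
Proof.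
move=> hH KA MB A2 B2 KM; split; apply/eqP => AB.
  apply: (signed_copies_differ (b := false) hH KA MB (KM ord0)) => j _.
  by rewrite AB addbb.
have AUB : #|A :|: B| = 4%N by rewrite cardsU AB cards0 A2 B2.
have /cards1P[p pE] : #|~: (A :|: B)| == 1%N.
  by rewrite -(eqn_add2l #|A :|: B|) cardsC AUB card_ord.
apply: (signed_copies_differ (b := true) hH KA MB (KM p)) => j jp.
have : j \in A :|: B by rewrite -[_ \in _]negbK -in_setC pE inE.
have : j \notin A :&: B by rewrite AB inE.
by rewrite !inE; do 2 case: (j \in _).
Qed.

End HollowFrames.

(** * Intersecting families of pairs *)

(** Either all pairs share a point x, and there are at most four, or three of
    them form a triangle a, b, c. In the second case no pair can meet all three
    sides while leaving the triangle. *)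
Lemma intersecting_pairs (F : {set {set 'I_5}}) :
    (forall A, A \in F -> #|A| = 2%N) ->
    (forall A B, A \in F -> B \in F -> A :&: B != set0) ->
  (#|F| <= 4)%N.
Proof.
move=> F2 Fmeet.
have other (A : {set 'I_5}) x : #|A| = 2%N -> x \in A ->
    exists2 y, y != x & A = [set x; y].
  move=> /eqP/cards2P[y [z [yz ->]]]; rewrite !inE => /orP[] /eqP ->.
    by exists z; rewrite // eq_sym.
  by exists y; rewrite // setUC.
have [/existsP[x /forallP xF]|] :=
    boolP [exists x, forall A, (A \in F) ==> (x \in A)].
  have sF : F \subset [set [set x; y] | y in [set~ x]].
    apply/subsetP => A AF.
    have [y yx ->] := other A x (F2 A AF) (implyP (xF A) AF).
    by apply/imsetP; exists y; rewrite ?inE.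
  apply: leq_trans (subset_leq_card sF) _.
  by apply: leq_trans (leq_imset_card _ _) _; rewrite cardsC1 card_ord.
rewrite negb_exists => /forallP noF.
have miss x : exists2 A, A \in F & x \notin A.
  have := noF x; rewrite negb_forall => /existsP[A].
  by rewrite negb_imply => /andP[]; exists A.
have hit A B x y :
    A \in F -> B \in F -> A = [set x; y] -> x \notin B -> y \in B.
  move=> AF BF AE xB; have /set0Pn[z] := Fmeet A B AF BF.
  by rewrite AE !inE => /andP[/orP[]/eqP -> //]; rewrite (negPf xB).
have [A AF _] := miss ord0.
have /eqP/cards2P[a [b [ab AE]]] := F2 A AF.
have [B BF aB] := miss a; have bB := hit A B a b AF BF AE aB.
have [c cb BE] := other B b (F2 B BF) bB.
have [D DF bD] := miss b.
have aD : a \in D by apply: (hit A D b a); rewrite // setUC.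
have cD : c \in D by apply: (hit B D b c).
have ac : a != c by apply: contraNneq aB => ->; rewrite BE !inE eqxx orbT.
have DE : D = [set a; c].
  by apply/esym/eqP; rewrite eqEcard subUset !sub1set aD cD F2 // cards2 ac.
have sF : F \subset
    [set E : {set 'I_5} | E \subset [set a; b; c] & #|E| == 2%N].
  apply/subsetP => E EF; rewrite inE F2 // eqxx andbT.
  apply/subsetP => x xE; rewrite !inE; apply/negPn/negP; rewrite !negb_or.
  case/andP => /andP[xa xb] xc.
  have [y yx EE] := other E x (F2 E EF) xE.
  have yin G : G \in F -> x \notin G -> y \in G by move=> GF; apply: hit EE.
  move: (yin A AF) (yin B BF) (yin D DF).
  rewrite AE BE DE !inE !negb_or xa xb xc => /(_ isT) + /(_ isT) + /(_ isT).
  case/orP=> /eqP ->; first by rewrite (negPf ab) (negPf ac).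
  by move=> _; rewrite (eq_sym b a) (negPf ab) (eq_sym b c) (negPf cb).
apply: leq_trans (subset_leq_card sF) _.
have abc3 : (#|[set a; b; c]| <= 3)%N.
  rewrite (leq_trans (leq_card_setU _ _)) // cards1 addn1 ltnS.
  by rewrite cards2; case: (a != b).
rewrite cards_draws; apply: leq_trans (leq_bin2l 2 abc3) _; by [].
Qed.

(** * From weighing matrices to frames with zero diagonal *)

Section UnitWeighing.
Variable R : realType.
Implicit Types (H K L M W : 'M[R[i]]_5) (s t : 'S_5) (p q j k : 'I_5).

Lemma one_zero_of_four (v : 'I_5 -> R[i]) :
    (forall j, `|v j| = 0 \/ `|v j| = 1) -> \sum_j v j * (v j)^* = 4%:R ->
  exists p, forall j, `|v j| = (p != j)%:R.
Proof.
move=> v01 v4; pose Z := [set j | v j == 0].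
have vE j : `|v j| = (j \notin Z)%:R.
  rewrite inE; have [|] := v01 j => vj; first by rewrite -normr_eq0 vj eqxx.
  by rewrite -normr_eq0 vj oner_eq0.
have : (#|~: Z|%:R : R[i]) = 4%:R.
  rewrite -v4 -sum1_card natr_sum big_mkcond /=; apply: eq_bigr => j _.
  by rewrite -normCK vE inE; case: (j \in Z); rewrite ?expr0n ?expr1n.
move/eqP; rewrite eqr_nat => /eqP Z4.
have /cards1P[p ZE] : #|Z| == 1%N.
  by rewrite -(eqn_add2r #|~: Z|) cardsC card_ord Z4.
by exists p => j; rewrite vE ZE inE eq_sym.
Qed.

Lemma weighing_row_zero W p :
  unit_weighing 4 W -> exists q, forall j, `|W p j| = (q != j)%:R.
Proof.
case=> W01 WW; apply: one_zero_of_four => //.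
by rewrite -mulmx_adjE WW mxE eqxx.
Qed.

Lemma weighing_adj W : unit_weighing 4 W -> W ^t* *m W = 4%:R%:M.
Proof.
case=> _ WW; have n4 : (4%:R : R[i]) != 0 by rewrite (eqr_nat _ 4 0).
have /mulmx1C : W *m (4%:R^-1 *: W ^t*) = 1%:M.
  by rewrite -scalemxAr WW scale_scalar_mx mulVf.
rewrite -scalemxAl => e.
have -> : W ^t* *m W = 4%:R *: (4%:R^-1 *: (W ^t* *m W)).
  by rewrite scalerA mulfV ?scale1r.
by rewrite e scale_scalar_mx mulr1.
Qed.

Lemma weighing_col_zero W j :
  unit_weighing 4 W -> exists q, forall p, `|W p j| = (q != p)%:R.
Proof.
move=> uW; apply: (@one_zero_of_four (W^~ j)) => [p|]; first by case: uW.
have := congr1 (fun M : 'M_5 => M j j) (weighing_adj uW).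
rewrite !mxE eqxx mulr1n => <-.
by apply: eq_bigr => p _; rewrite !mxE mulrC.
Qed.

Lemma row_perm_inner s t K M p q :
  (row_perm s K *m (row_perm t M) ^t*) p q = (K *m M ^t*) (s p) (t q).
Proof.
by rewrite !mulmx_adjE; apply: eq_bigr => j _; rewrite !mxE.
Qed.

(** Let i be the row in which column p vanishes; the only zero of row i is at
    p. *)
Lemma weighing_hollow W :
  unit_weighing 4 W -> exists s, hollow_frame (row_perm s W).
Proof.
move=> uW.
have /fin_all_exists[f fP] p : exists i, forall j, `|W i j| = (p != j)%:R.
  have [i Wi] := weighing_col_zero p uW; have [q Wq] := weighing_row_zero i uW.
  exists i => j; rewrite Wq; suff -> : q = p by [].
  have := Wi i; rewrite Wq eqxx => /eqP; rewrite (eqr_nat _ _ 0) eqb0 negbK.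
  by move/eqP.
have f_inj : injective f.
  move=> p q fpq; have := fP p p; rewrite fpq fP eqxx => /eqP.
  by rewrite (eqr_nat _ _ 0) eqb0 negbK => /eqP.
exists (perm f_inj); split=> [p j|p q pq]; first by rewrite mxE permE fP.
rewrite row_perm_inner (proj2 uW) mxE !permE.
by rewrite (inj_eq f_inj) (negPf pq).
Qed.

Lemma sqrtC4 : sqrtC (4%:R : R[i]) = 2%:R.
Proof. by rewrite -[4%N]/(2 ^ 2)%N natrX sqrCK // ler0n. Qed.

Lemma unbiased_row_perm K H s t :
  unbiased 4 K H -> unbiased_frames (row_perm s K) (row_perm t H).
Proof.
case=> L [uL KH]; have KHE p q :
    (row_perm s K *m (row_perm t H) ^t*) p q = 2%:R * L (s p) (t q).
  by rewrite row_perm_inner KH sqrtC4 mxE.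
split=> [p q|p].
  rewrite /zero_or_two KHE normrM normr_nat.
  by case: (proj1 uL (s p) (t q)) => ->; rewrite ?mulr0 ?mulr1; [left|right].
have [q Lq] := weighing_row_zero (s p) uL.
exists ((t^-1)%g q); rewrite KHE permKV.
by have /eqP := Lq q; rewrite eqxx normr_eq0 => /eqP ->; rewrite mulr0.
Qed.

End UnitWeighing.

Section UpperBound.
Variable R : realType.
Implicit Types (H K M : 'M[R[i]]_5) (s t : 'S_5).

(** The rigidity theorem for a weighing matrix K with rows in any order. *)
Lemma unbiased_signed_copy H K s :
    hollow_frame (row_perm s H) -> unit_weighing 4 K -> unbiased 4 K H ->
  exists (A : {set 'I_5}) t,
    #|A| = 2%N /\ signed_copy (row_perm s H) A (row_perm t K).
Proof.
move=> hH /weighing_hollow[t hK] /(unbiased_row_perm t s) KH.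
have [B KB] := signed_copy_exists hH hK KH.
have [A A2 KA] := signed_copy_card hH KB (fun p => proj1 KH p p).
by exists A, t.
Qed.

End UpperBound.

(** * The construction from cube roots of unity *)

Section Construction.
Variable R : realType.
Implicit Types (H : 'M[R[i]]_5) (p q j k : 'I_5).

Lemma hollow_frame_weighing H : hollow_frame H -> unit_weighing 4 H.
Proof.
case=> nH oH; split=> [p j|].
  by rewrite nH; case: (p != j); [right|left].
apply/matrixP => p q; have [<-|pq] := eqVneq p q; last first.
  by rewrite oH // mxE (negPf pq).
rewrite mulmx_adjE [RHS]mxE eqxx mulr1n (bigD1 p) //= -normCK nH eqxx expr0n.
rewrite add0r (eq_bigr (fun=> 1)) => [|j jp].
  by rewrite sumr_const cardC1 card_ord.
by rewrite -normCK nH eq_sym jp expr1n.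
Qed.

Definition flip H k : 'M[R[i]]_5 := \matrix_(p, j) ((-1) ^+ (j == k) * H p j).

Lemma flip_weighing H k : unit_weighing 4 H -> unit_weighing 4 (flip H k).
Proof.
case=> H01 HH; split=> [p j|]; first by rewrite mxE normrM normr_sign mul1r.
rewrite -HH; apply/matrixP => p q; rewrite !mulmx_adjE; apply: eq_bigr => j _.
by rewrite !mxE rmorphM rmorph_sign mulrACA -expr2 sqrr_sign mul1r.
Qed.

(** The signs of the two flips differ exactly in the columns j and k. *)
Lemma flip_inner H j k p q : j != k ->
  (flip H j *m (flip H k) ^t*) p q =
    (H *m H ^t*) p q - 2%:R * (H p j * (H q j)^* + H p k * (H q k)^*).
Proof.
move=> jk; have kj : k != j by rewrite eq_sym.
rewrite !mulmx_adjE (bigD1 j) // (bigD1 k) //=.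
rewrite [in RHS](bigD1 j) // (bigD1 k) //=.
rewrite !mxE !rmorphM !rmorph_sign !eqxx (negPf jk) (negPf kj) /=.
rewrite (eq_bigr (fun x => H p x * (H q x)^*)) => [|x /andP[xj xk]]; last first.
  by rewrite !mxE rmorphM rmorph_sign (negPf xj) (negPf xk) !mul1r.
ring.
Qed.

(** By [flip_inner], half of the product is the scalar matrix 2 minus the sum
    of the contributions of columns j and k to the Gram matrix of H. For
    distinct rows p, q each contribution has modulus 0 or 1; if neither
    vanishes, their sum is the negative of the third contribution. *)
Lemma flips_unbiased H j k :
  hollow_frame H -> j != k -> unbiased 4 (flip H j) (flip H k).
Proof.
move=> hH jk; have uH := hollow_frame_weighing hH.
have n2 : (2%:R : R[i]) != 0 by rewrite (eqr_nat _ 2 0).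
pose L := 2%:R^-1 *: (flip H j *m (flip H k) ^t*).
exists L; split; last by rewrite sqrtC4 scalerA mulfV // scale1r.
have LE p q : L p q =
    2%:R^-1 * (H *m H ^t*) p q - (H p j * (H q j)^* + H p k * (H q k)^*).
  by rewrite mxE flip_inner // mulrBr mulKf.
split=> [p q|]; last first.
  have LtE : L ^t* = 2%:R^-1 *: (flip H k *m (flip H j) ^t*).
    rewrite linearZ /= map_mxZ trmx_mul map_mxM -[in RHS](trmxCK (flip H k)).
    by rewrite fmorphV rmorph_nat.
  rewrite LtE -scalemxAl -scalemxAr scalerA mulmxA -(mulmxA (flip H j)).
  rewrite (weighing_adj (flip_weighing k uH)) mul_mx_scalar -scalemxAl.
  rewrite (proj2 (flip_weighing j uH)) !scale_scalar_mx; congr _%:M; by field.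
rewrite LE; have [<-|pq] := eqVneq p q.
  rewrite (proj2 uH) mxE eqxx mulr1n -!normCK !(proj1 hH).
  have -> : (2%:R^-1 * 4%:R : R[i]) = 2%:R by field.
  have [pj|pj] := eqVneq p j; first rewrite pj jk.
    by rewrite expr0n expr1n add0r -[2%:R](natrD _ 1 1) addrK normr1; right.
  rewrite expr1n; case: (p != k); rewrite ?expr1n ?expr0n.
    by rewrite subrr normr0; left.
  by rewrite addr0 -[2%:R](natrD _ 1 1) addrK normr1; right.
rewrite (proj2 hH) // mulr0 sub0r normrN.
have n1 x : x != p -> x != q -> `|H p x * (H q x)^*| = 1.
  by move=> xp xq; rewrite normrM norm_conjC !hollow_unit // mulr1.
have n0 x : (x == p) || (x == q) -> H p x * (H q x)^* = 0.
  by case/orP => /eqP ->; rewrite hollow_diag // ?rmorph0 ?mulr0 ?mul0r.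
have n01 x : `|H p x * (H q x)^*| = 0 \/ `|H p x * (H q x)^*| = 1.
  have [/n0 ->|] := boolP ((x == p) || (x == q)); first by rewrite normr0; left.
  by rewrite negb_or => /andP[xp xq]; rewrite n1 //; right.
have [/n0 ->|] := boolP ((j == p) || (j == q)); first by rewrite add0r.
have [/n0 ->|] := boolP ((k == p) || (k == q)); first by rewrite addr0.
rewrite !negb_or => /andP[kp kq] /andP[jp jq].
have [l U] : exists l, uniq [:: p; q; j; k; l].
  apply: uniq_extend1; rewrite /= !inE !negb_or pq jk (eq_sym p j) (eq_sym p k).
  by rewrite (eq_sym q j) (eq_sym q k) jp jq kp kq.
have := hollow_inner3 hH hH U; rewrite (proj2 hH) // => /esym/eqP.
rewrite addr_eq0 => /eqP ->; rewrite normrN; exact: n01.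
Qed.

Lemma cube_root_exists : exists w : R[i], w ^+ 2 + w + 1 = 0.
Proof.
exists ((sqrtC (- 3%:R) - 1) / 2%:R).
have -> : forall s : R[i], ((s - 1) / 2%:R) ^+ 2 + (s - 1) / 2%:R + 1 =
    (s ^+ 2 + 3%:R) / 4%:R by move=> s; field.
by rewrite sqrtCK addNr mul0r.
Qed.

(** The diagonal entries are placeholders. The exponents of any two rows differ,
    in their three common places, by 0, 1 and 2 modulo 3. *)
Definition cube_root_exponent (p j : nat) : nat :=
  nth 0 (nth [::]
    [:: [:: 0; 0; 0; 0; 0]; [:: 0; 0; 0; 1; 2]; [:: 0; 0; 0; 2; 1];
        [:: 0; 1; 2; 0; 0]; [:: 0; 2; 1; 0; 0]] p) j.

Definition cube_root_frame (w : R[i]) : 'M[R[i]]_5 :=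
  \matrix_(p, j) ((p != j)%:R * w ^+ cube_root_exponent p j).

Lemma cube_root_hollow w :
  w ^+ 2 + w + 1 = 0 -> hollow_frame (cube_root_frame w).
Proof.
move=> wq; split=> [p j|p q pq].
  by rewrite mxE normrM normrX (cube_root_norm wq) expr1n mulr1 normr_nat.
have w3 := cube_root_unity wq.
(* Conjugation squares a cube root of unity, so it doubles the exponent. *)
rewrite mulmx_adjE (eq_bigr (fun j : 'I_5 => (p != j)%:R * (q != j)%:R *
   w ^+ ((cube_root_exponent p j + 2 * cube_root_exponent q j) %% 3)%N))
  => [|j _]; last first.
  rewrite !mxE rmorphM rmorphXn rmorph_nat /= (cube_root_conj wq) -exprM.
  by rewrite expr_mod // exprD; ring.
rewrite !big_ord_recl big_ord0; move: pq.
case: p => -[|[|[|[|[|//]]]]] pP; case: q => -[|[|[|[|[|//]]]]] qP //= _.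
all: rewrite -[RHS]wq /bump /=; ring.
Qed.

End Construction.

(** * The maximum *)

Local Open Scope classical_set_scope.
Local Open Scope card_scope.

Lemma flip_inj (R : realType) (H : 'M[R[i]]_5) :
  hollow_frame H -> injective (flip H).
Proof.
move=> hH j k jkE; apply/eqP/negPn/negP => jk.
have /eqP := congr1 (fun M : 'M_5 => M k j) jkE.
rewrite !mxE eqxx (negPf jk) mul1r mulN1r eq_sym -addr_eq0 -mulr2n mulrn_eq0 /=.
by rewrite -normr_eq0 hollow_unit // oner_eq0.
Qed.

Lemma flips_mutually_unbiased (R : realType) (H : 'M[R[i]]_5) :
    hollow_frame H ->
  mutually_unbiased 4 (flip H @` [set: 'I_5]) /\ flip H @` [set: 'I_5] #= `I_5.
Proof.
move=> hH; split; last first.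
  apply: card_eq_trans (_ : _ #= [set: 'I_5]) _.
    by apply: inj_card_eq => j k _ _; exact: flip_inj hH j k.
  by rewrite card_eq_sym; apply: card_II.
split=> [_ [k _ <-]|_ _ [j _ <-] [k _ <-] jk].
  exact/flip_weighing/hollow_frame_weighing.
by apply: flips_unbiased => //; apply/eqP => jkE; apply: jk; rewrite jkE.
Qed.

(** Fix a member H. By the rigidity theorem every other member K is H with a
    pair of columns negated, up to its row order and row phases; that pair is
    the code of K. Codes of distinct members are distinct and meet, so at most
    four members differ from H. *)
Lemma card_le_mutually_unbiased (R : realType) (S : set 'M[R[i]]_5) :
  mutually_unbiased 4 S -> S #<= `I_5.
Proof.
case=> uS bS.
have [->|/set0P[H SH]] := eqVneq S classical_sets.set0; first exact: card_ge0.
have [s hH] := weighing_hollow (uS H SH).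
(* H gets the empty code, so that one code tells all members of S apart. *)
pose codes (K : 'M[R[i]]_5) (A : {set 'I_5}) :=
  if `[< K = H >] then A = finset.set0 else
  #|A| = 2%N /\ exists t, signed_copy (row_perm s H) A (row_perm t K).
have /choice[code codeP] K : exists A, S K -> codes K A.
  have [SK|nSK] := pselect (S K); last by exists finset.set0.
  rewrite /codes; case: asboolP => [_|KH]; first by exists finset.set0.
  have [A [t [A2 KA]]] := unbiased_signed_copy hH (uS K SK) (bS K H SK SH KH).
  by exists A => _; split=> //; exists t.
have codeH : code H = finset.set0.
  by have := codeP H SH; rewrite /codes; case: asboolP.
have codeN K : S K -> K <> H -> #|code K| = 2%N /\
    exists t, signed_copy (row_perm s H) (code K) (row_perm t K).
  by move=> SK KH; have := codeP K SK; rewrite /codes; case: asboolP.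
have code_meet K M : S K -> S M -> K <> H -> M <> H -> K <> M ->
    code K != code M /\ code K :&: code M != finset.set0.
  move=> SK SM KH MH KM.
  have [K2 [t tK]] := codeN K SK KH; have [M2 [u uM]] := codeN M SM MH.
  apply: (signed_copies_meet hH tK uM K2 M2) => p.
  by case: (unbiased_row_perm t u (bS K M SK SM KM)).
pose F :=
  [set A : {set 'I_5} | `[< exists K, [/\ S K, K <> H & code K = A] >]]%SET.
have F4 : (#|F| <= 4)%N.
  apply: intersecting_pairs => [A|A B].
    by rewrite inE => /asboolP[K [SK KH <-]]; case: (codeN K SK KH).
  rewrite !inE => /asboolP[K [SK KH <-]] /asboolP[M [SM MH <-]].
  have [->|KM] := pselect (K = M); last by case: (code_meet K M SK SM KH MH KM).
  by rewrite finset.setIid -card_gt0; have [-> _] := codeN M SM MH.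
pose G := finset.set0 |: F.
have codeG K : S K -> code K \in G.
  move=> SK; rewrite !inE; have [->|KH] := pselect (K = H).
    by rewrite codeH eqxx.
  by apply/orP; right; apply/asboolP; exists K.
have code_inj K M : S K -> S M -> code K = code M -> K = M.
  have notH N : S N -> N <> H -> code N <> finset.set0.
    by move=> SN NH N0; have [] := codeN N SN NH; rewrite N0 cards0.
  move=> SK SM KM; have [KH|KH] := pselect (K = H).
    apply: contrapT => MK; apply: (notH M SM) => [MH|].
      by apply: MK; rewrite MH.
    by rewrite -KM KH.
  have [MH|MH] := pselect (M = H); first by case: (notH K SK KH); rewrite KM MH.
  apply: contrapT => /(code_meet K M SK SM KH MH)[].
  by rewrite KM eqxx.
apply/pcard_leP/injfunPex; exists (fun K => index (code K) (enum G)).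
  move=> K SK /=; apply: (@leq_trans (size (enum G))).
    by rewrite index_mem mem_enum codeG.
  rewrite -cardE cardsU1 -[5%N]/(1 + 4)%N leq_add //.
  by case: (_ \notin _).
move=> K M /set_mem SK /set_mem SM /= KM; apply: code_inj => //.
rewrite -(nth_index finset.set0 (_ : code K \in enum G)) ?mem_enum ?codeG //.
by rewrite KM nth_index ?mem_enum ?codeG.
Qed.

Theorem theorem18 (R : realType) :
  (exists S : set 'M[R[i]]_5, mutually_unbiased 4 S /\ S #= `I_5) /\
  (forall S : set 'M[R[i]]_5, mutually_unbiased 4 S -> S #<= `I_5).
Proof.
split; last exact: card_le_mutually_unbiased.
have [w wq] := cube_root_exists R.
by eexists; apply: flips_mutually_unbiased (cube_root_hollow wq).
Qed.
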